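(* Let $U$ be a $5$-unitrade with $|U|=16$. Then $U$ is equivalent to exactly one of the following kinds of collections (up to equivalence): (1) $W\cup R$, where $W$ is a $5$-unitrade equivalent to $W_5$, $R$ is a $5$-unitrade equivalent to $R_5$, and $W\cap R=\emptyset$; (2) $E=\{\{1,2,3,5,6\}, \{1,2,4,5,6\}, \{1,3,4,5,6\}, \{2,3,4,5,6\}, \{1,2,3,5,7\}, \{1,2,4,5,7\}, \{1,3,4,5,7\}, \{2,3,4,5,7\}, \{1,2,3,6,7\}, \{1,2,4,6,7\}, \{1,3,4,6,7\}, \{2,3,4,6,8\},\{2,3,4,7,8\},\{2,3,6,7,8\},\{2,4,6,7,8\},\{3,4,6,7,8\}\}$; (3) $F=\{\{1,2,3,5,7\}, \{1,2,4,5,7\}, \{1,3,4,5,7\}, \{2,3,4,5,7\}, \{1,2,3,6,7\}, \{1,2,4,6,7\}, \{1,3,4,6,7\}, \{2,3,4,6,7\}, \{1,2,3,6,8\}, \{1,2,4,6,8\}, \{1,3,4,6,8\}, \{2,3,4,6,8\}, \{1,2,3,5,8\}, \{1,2,4,5,8\}, \{1,3,4,5,8\}, \{2,3,4,5,8\}\}$.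
   Context: Let $V$ be a finite set. A $k$-unitrade on $V$ is a set $U$ of $k$-element subsets (blocks) of $V$ such that every $(k-1)$-element subset of $V$ is contained in an even number of blocks of $U$. Two collections $U_1$ of subsets of a set $V_1$ and $U_2$ of subsets of a set $V_2$ are equivalent if there is an injection $f:V_1\to V_2$ with $U_2=\{f(u): u\in U_1\}$. $W_5$ denotes the set of all $5$-element subsets of $\{1,\dots,6\}$, and $R_5=\{\{2,3,4,5,6\},\{1,3,4,5,6\},\{1,2,4,5,6\},\{1,2,3,5,6\},\{1,2,3,4,6\},\{2,3,4,5,7\},\{1,3,4,5,7\},\{1,2,4,5,7\},\{1,2,3,5,7\},\{1,2,3,4,7\}\}$. *)

(* Defs.v *)
From mathcomp Require Import ssreflect ssrfun ssrbool eqtype ssrnat seq choice fintype finset.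
Set Implicit Arguments. Unset Strict Implicit. Unset Printing Implicit Defensive.

Definition unitrade (V : finType) (k : nat) (U : {set {set V}}) : Prop :=
  (forall B, B \in U -> #|B| = k) /\
  (forall S : {set V}, #|S| = k.-1 -> ~~ odd #|[set B in U | S \subset B]|).

Definition equiv (V1 V2 : finType) (U1 : {set {set V1}}) (U2 : {set {set V2}})
  : Prop :=
  exists f : V1 -> V2, injective f /\ U2 = (fun u : {set V1} => f @: u) @: U1.

(* Points 1..n are encoded as the ordinals 0..n-1 of 'I_n. *)
Definition blk (n : nat) (l : seq nat) : {set 'I_n} :=
  [set i : 'I_n | (val i).+1 \in l].

Definition coll (n : nat) (ls : seq (seq nat)) : {set {set 'I_n}} :=
  [set B | B \in map (blk n) ls].

Definition W5 : {set {set 'I_6}} := [set B : {set 'I_6} | #|B| == 5].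

Definition R5 : {set {set 'I_7}} :=
  coll 7 [:: [:: 2;3;4;5;6]; [:: 1;3;4;5;6]; [:: 1;2;4;5;6]; [:: 1;2;3;5;6];
             [:: 1;2;3;4;6]; [:: 2;3;4;5;7]; [:: 1;3;4;5;7]; [:: 1;2;4;5;7];
             [:: 1;2;3;5;7]; [:: 1;2;3;4;7]].

Definition E8 : {set {set 'I_8}} :=
  coll 8 [:: [:: 1;2;3;5;6]; [:: 1;2;4;5;6]; [:: 1;3;4;5;6]; [:: 2;3;4;5;6];
             [:: 1;2;3;5;7]; [:: 1;2;4;5;7]; [:: 1;3;4;5;7]; [:: 2;3;4;5;7];
             [:: 1;2;3;6;7]; [:: 1;2;4;6;7]; [:: 1;3;4;6;7]; [:: 2;3;4;6;8];
             [:: 2;3;4;7;8]; [:: 2;3;6;7;8]; [:: 2;4;6;7;8]; [:: 3;4;6;7;8]].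

Definition F8 : {set {set 'I_8}} :=
  coll 8 [:: [:: 1;2;3;5;7]; [:: 1;2;4;5;7]; [:: 1;3;4;5;7]; [:: 2;3;4;5;7];
             [:: 1;2;3;6;7]; [:: 1;2;4;6;7]; [:: 1;3;4;6;7]; [:: 2;3;4;6;7];
             [:: 1;2;3;6;8]; [:: 1;2;4;6;8]; [:: 1;3;4;6;8]; [:: 2;3;4;6;8];
             [:: 1;2;3;5;8]; [:: 1;2;4;5;8]; [:: 1;3;4;5;8]; [:: 2;3;4;5;8]].

Definition kind1 (V : finType) (U : {set {set V}}) : Prop :=
  exists W R : {set {set V}},
    [/\ unitrade 5 W /\ unitrade 5 R, equiv W5 W, equiv R5 R,
        W :&: R = set0 & U = W :|: R].

Definition kind2 (V : finType) (U : {set {set V}}) : Prop := equiv E8 U.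
Definition kind3 (V : finType) (U : {set {set V}}) : Prop := equiv F8 U.

(* Main.v *)
Require Import Defs.
From mathcomp Require Import ssreflect ssrfun ssrbool eqtype ssrnat seq choice fintype finset.
From mathcomp Require Import bigop zify.

(** A k-unitrade is a cycle mod 2 of (k-1)-simplices.  Cycles are added by symmetric
    difference [sd]; [bd S] is the boundary of the simplex [S], and [jbd P Q] the join of
    the boundaries of [P] and [Q], which has [#|P| * #|Q|] blocks.  If a cycle [G] has the
    same link at [x] as [U], then [sd U G] no longer involves [x], and its volume is
    controlled by the few blocks of [G] avoiding [x].  Links being unitrades of lower
    rank, this gives by induction that a nonempty k-unitrade is [bd S] (volume k+1), is
    [jbd {a,b} M] (volume 2k), or has volume above 2k: if no link is minimal, degree
    counting bounds the support by k+1 points.  Unitrades supported on k+2 points are all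
    of the form [jbd P Q].

    For k = 5 and volume 16, degree counting yields a point whose link has volume at most
    10.  Such a link is [bd S], [jbd P Q] of type (4,2) or (3,3), or a disjoint union of
    two boundaries; adding the corresponding cone leaves a unitrade of volume 12, 10 or 6,
    and each of these produces either a subunitrade of volume 6 or 10 in [U] (kind 1), or
    one of the two exceptional collections.  The degrees of the points tell the three kinds
    apart: only kinds 2 and 3 have a point of degree 12, and of these only kind 2 has a
    point of degree 5. *)

Set Implicit Arguments. Unset Strict Implicit. Unset Printing Implicit Defensive.

(** * Simplex boundaries, their joins, links, and block counts *)

Section Collections.
Variable V : finType.
Implicit Types (x y : V) (B C S T P Q N : {set V}) (U G : {set {set V}}).

Definition sd U G : {set {set V}} := [set B | (B \in U) (+) (B \in G)].

Definition bd S : {set {set V}} :=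
  [set B : {set V} | (B \subset S) && (#|S :\: B| == 1)].

Definition jbd P Q : {set {set V}} :=
  [set B : {set V} | [&& B \subset P :|: Q, #|P :\: B| == 1 & #|Q :\: B| == 1]].

Definition above T U : {set {set V}} := [set B in U | T \subset B].

Definition link x U : {set {set V}} := [set C : {set V} | (x \notin C) && (x |: C \in U)].

Definition vol U : nat := #|U|.

Definition deg x U : nat := vol [set B in U | x \in B].

Lemma sdC U G : sd U G = sd G U.
Proof. by apply/setP => B; rewrite !inE addbC. Qed.

Lemma sdK G : cancel (fun U => sd U G) (fun U => sd U G).
Proof. by move=> U; apply/setP => B; rewrite !inE addbK. Qed.

Lemma sd_eq0 U G : sd U G = set0 -> U = G.
Proof. by move/setP=> h; apply/setP => B; move: (h B); rewrite !inE; do 2 case: (_ \in _). Qed.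

Lemma card_sd U G : vol (sd U G) + 2 * vol (U :&: G) = vol U + vol G.
Proof.
have -> : sd U G = (U :\: G) :|: (G :\: U).
  by apply/setP => B; rewrite !inE; do 2 case: (_ \in _).
rewrite /vol cardsU (_ : _ :&: _ = set0); last first.
  by apply/setP => B; rewrite !inE; do 2 case: (_ \in _).
rewrite cards0 -(cardsID G U) -(cardsID U G) (setIC G U).
by move: #|_ :&: _| #|U :\: G| #|G :\: U| => *; lia.
Qed.

Lemma sd_subset G U : G \subset U -> sd U G = U :\: G.
Proof.
move/subsetP=> h; apply/setP => B; rewrite !inE.
by case: (boolP (B \in G)) => [/h->|_]; case: (B \in U).
Qed.

(** In the sum, the number of blocks above [S] is the total of the two counts minus twice the number
    of common blocks, so evenness survives. *)
Lemma unitrade_sd k U G : unitrade k U -> unitrade k G -> unitrade k (sd U G).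
Proof.
move=> [hU eU] [hG eG]; split=> [B|S hS].
  by rewrite inE; case: (boolP (B \in U)) => [/hU //|_] /= /hG.
have := card_sd (above S U) (above S G).
have -> : sd (above S U) (above S G) = [set B in sd U G | S \subset B].
  by apply/setP => B; rewrite !inE; case: (S \subset B); rewrite ?andbT ?andbF.
move: (eU S hS) (eG S hS); rewrite -/(vol (above S U)) -/(vol (above S G)) -/(vol _); lia.
Qed.

Lemma bdP S B : reflect (exists2 s, s \in S & B = S :\ s) (B \in bd S).
Proof.
apply: (iffP idP) => [|[s sS ->]].
  rewrite inE => /andP[BS /cards1P[s hs]].
  have : s \in S :\: B by rewrite hs set11.
  rewrite inE => /andP[_ sS]; exists s => //.
  by rewrite -hs setDDr setDv set0U; apply/esym/setIidPr.
rewrite inE subD1set /= (_ : _ :\: _ = [set s]) ?cards1 //.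
by apply/setP => z; rewrite !inE; case: (eqVneq z s) => [->|_]; rewrite ?sS //=; case: (z \in S).
Qed.

Lemma jbdP P Q B : [disjoint P & Q] ->
  reflect (exists p q, [/\ p \in P, q \in Q & B = (P :|: Q) :\: [set p; q]])
          (B \in jbd P Q).
Proof.
move=> dPQ; apply: (iffP idP) => [|[p [q [pP qQ ->]]]].
  rewrite inE => /and3P[BS /cards1P[p hp] /cards1P[q hq]].
  have : p \in P :\: B by rewrite hp set11.
  have : q \in Q :\: B by rewrite hq set11.
  rewrite !inE => /andP[_ qQ] /andP[_ pP]; exists p, q; split=> //.
  by rewrite -hp -hq -setDUl setDDr setDv set0U; apply/esym/setIidPr.
rewrite inE subsetDl /= (_ : P :\: _ = [set p]) ?cards1; last first.
  apply/setP => z; rewrite !inE; case: (eqVneq z p) => [->|_]; rewrite ?pP //=.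
  case: (eqVneq z q) => [->|_] /=; first by rewrite (disjointFl dPQ).
  by case: (z \in P); rewrite ?andbF.
rewrite (_ : Q :\: _ = [set q]) ?cards1 //.
apply/setP => z; rewrite !inE; case: (eqVneq z q) => [->|_]; rewrite ?qQ ?orbT //= ?orbF.
case: (eqVneq z p) => [->|_] /=; first by rewrite (disjointFr dPQ).
by case: (z \in Q); rewrite ?orbT ?andbF.
Qed.

Lemma jbdC P Q : jbd P Q = jbd Q P.
Proof. by apply/setP => B; rewrite !inE setUC; congr (_ && _); rewrite andbC. Qed.

(** The boundary of a single point consists of the empty block alone, so joining with it changes
    nothing. This is what turns the link at [a] of [jbd [set a; b] M] into [bd M]. *)
Lemma jbd1 x S : x \notin S -> jbd [set x] S = bd S.
Proof.
move=> xS; apply/setP => B; rewrite !inE.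
have -> : (#|[set x] :\: B| == 1) = (x \notin B).
  case: (boolP (x \in B)) => xB /=.
    rewrite (_ : _ :\: _ = set0) ?cards0 //.
    by apply/setP => z; rewrite !inE; case: (eqVneq z x) => [->|]; rewrite ?xB ?andbF.
  rewrite (_ : _ :\: _ = [set x]) ?cards1 //.
  by apply/setP => z; rewrite !inE; case: (eqVneq z x) => [->|]; rewrite ?xB ?andbF.
rewrite andbA; congr (_ && _); apply/andP/subsetP => [[/subsetP h xB] z zB|h].
  by move: (h z zB); rewrite !inE; case: eqP => // e; rewrite -e zB in xB.
split; last by apply: contra xS; apply: h.
by apply/subsetP => z /h; rewrite !inE => ->; rewrite orbT.
Qed.

(** A facet contains [T] exactly when the point it omits lies outside [T]. One count thus gives
    volumes ([T] empty), degrees ([T] a singleton) and the parity condition. *)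
Lemma card_above_bd S T : T \subset S -> vol (above T (bd S)) = #|S :\: T|.
Proof.
move=> TS; rewrite -(@card_in_imset _ _ (fun s => S :\ s) (S :\: T)); last first.
  move=> s t; rewrite !inE => /andP[_ sS] _ /setP/(_ s).
  by rewrite !inE eqxx sS andbT /=; case: eqP.
apply: eq_card => B; rewrite [LHS]inE; apply/andP/imsetP => [[/bdP[s sS ->] h]|[s hs ->]].
  exists s => //; rewrite inE sS andbT; apply/negP => /(subsetP h).
  by rewrite !inE eqxx.
move: hs; rewrite in_setD => /andP[sT sS]; split; first by apply/bdP; exists s.
by rewrite subsetD1 TS.
Qed.

Lemma card_above_jbd P Q T : [disjoint P & Q] -> T \subset P :|: Q ->
  vol (above T (jbd P Q)) = #|P :\: T| * #|Q :\: T|.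
Proof.
move=> dPQ TS; rewrite -cardsX.
rewrite -(@card_in_imset _ _ (fun u => (P :|: Q) :\: [set u.1; u.2])
           (setX (P :\: T) (Q :\: T))); last first.
  move=> [p q] [p' q']; rewrite !inE /= => /andP[/andP[_ pP] /andP[_ qQ]].
  move=> /andP[/andP[_ pP'] /andP[_ qQ']] /setP e.
  have := e p; have := e q; rewrite !inE !eqxx pP qQ !orbT !andbT /=.
  case: (eqVneq q p') => [eq|_ /=]; first by rewrite eq (disjointFr dPQ pP') in qQ.
  case: eqP => // -> _; case: (eqVneq p q') => [eq|_]; last by case: eqP => // ->.
  by rewrite eq (disjointFl dPQ qQ') in pP.
apply: eq_card => B; rewrite [LHS]inE;
  apply/andP/imsetP => [[/(jbdP _ dPQ)[p [q [pP qQ ->]]] h]|[[p q] hpq ->]].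
  exists (p, q) => //; rewrite !inE pP qQ !andbT /=; apply/andP; split; apply/negP => /(subsetP h).
    by rewrite !inE eqxx.
  by rewrite !inE eqxx orbT.
move: hpq; rewrite in_setX 2!in_setD /= => /andP[/andP[pT pP] /andP[qT qQ]]; split.
  by apply/(jbdP _ dPQ); exists p, q.
apply/subsetP => z zT; rewrite !inE -in_setU (subsetP TS) // andbT.
by apply/negP => /orP[]/eqP e; rewrite -e zT in pT qT.
Qed.

Lemma above0 U : above set0 U = U.
Proof. by apply/setP => B; rewrite inE sub0set andbT. Qed.

Lemma above1 x U : vol (above [set x] U) = deg x U.
Proof. by apply: eq_card => B; rewrite !inE sub1set. Qed.

Lemma card_bd S : vol (bd S) = #|S|.
Proof. by rewrite -[bd S]above0 card_above_bd ?sub0set // setD0. Qed.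

Lemma card_jbd P Q : [disjoint P & Q] -> vol (jbd P Q) = #|P| * #|Q|.
Proof. by move=> h; rewrite -[jbd P Q]above0 card_above_jbd ?sub0set // !setD0. Qed.

Lemma above_out T N U : (forall B, B \in U -> B \subset N) -> ~~ (T \subset N) ->
  vol (above T U) = 0.
Proof.
move=> h hT; apply/eqP; rewrite cards_eq0; apply/eqP/setP => B; rewrite !inE.
by apply/negP => /andP[/h BN TB]; case/negP: hT; apply: subset_trans BN.
Qed.

Lemma bd_sub S B : B \in bd S -> B \subset S.
Proof. by rewrite inE => /andP[]. Qed.

Lemma jbd_sub P Q B : B \in jbd P Q -> B \subset P :|: Q.
Proof. by rewrite inE => /andP[]. Qed.

Lemma cardsDsub S T : T \subset S -> #|S :\: T| + #|T| = #|S|.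
Proof. by move=> h; rewrite cardsDS // subnK // subset_leq_card. Qed.

Lemma unitrade_bd k S : 0 < k -> #|S| = k.+1 -> unitrade k (bd S).
Proof.
move=> k0 hS; split=> [B|T hT].
  by rewrite inE => /andP[/cardsDsub h /eqP e]; lia.
rewrite -/(vol (above T (bd S))); case: (boolP (T \subset S)) => h.
  by rewrite card_above_bd //; move: (cardsDsub h); lia.
by rewrite (above_out (@bd_sub S) h).
Qed.

(** A set [T] of [k.-1] points of [P :|: Q] leaves three points outside it, shared between [P] and
    [Q]. Three is odd, so one of the two shares is even, and so is their product. *)
Lemma unitrade_jbd k P Q : 0 < k -> [disjoint P & Q] -> #|P| + #|Q| = k.+2 ->
  unitrade k (jbd P Q).
Proof.
move=> k0 dPQ hS; have cU : #|P :|: Q| = k.+2 by rewrite cardsU (disjoint_setI0 dPQ) cards0 subn0.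
have cD B : #|P :\: B| + #|Q :\: B| = #|(P :|: Q) :\: B|.
  rewrite setDUl cardsU (_ : _ :&: _ = set0) ?cards0 ?subn0 //.
  apply/setP => z; rewrite !inE; case: (boolP (z \in P)) => [/(disjointFr dPQ)->|]; by rewrite !andbF.
split=> [B|T hT].
  by rewrite inE => /and3P[/cardsDsub h /eqP e1 /eqP e2]; move: (cD B); lia.
rewrite -/(vol (above T (jbd P Q))); case: (boolP (T \subset P :|: Q)) => h.
  rewrite card_above_jbd // oddM; move: (cardsDsub h) (cD T) => h1 h2.
  have: #|P :\: T| + #|Q :\: T| = 3 by lia.
  by move: #|P :\: T| #|Q :\: T| => a b; lia.
by rewrite (above_out (@jbd_sub P Q) h).
Qed.

Lemma card_link x U : vol (link x U) = deg x U.
Proof.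
rewrite /deg /vol -(@card_in_imset _ _ (fun C => x |: C) (link x U)); last first.
  move=> C D; rewrite !inE => /andP[xC _] /andP[xD _] e.
  by rewrite -(setU1K xC) e setU1K.
apply: eq_card => B; rewrite [RHS]inE; apply/imsetP/andP => [[C]|[BU xB]].
  by rewrite inE => /andP[xC xU] ->; rewrite setU11.
by exists (B :\ x); rewrite ?inE ?eqxx /= setD1K.
Qed.

Lemma in_link x U B : x \in B -> (B :\ x \in link x U) = (B \in U).
Proof. by move=> xB; rewrite inE !inE eqxx /= setD1K. Qed.

(** For [T] avoiding [x], adding [x] matches the blocks of the link above [T] with the blocks of [U]
    above [x |: T], and the latter set has the size to which evenness in [U] applies. *)
Lemma unitrade_link k x U : unitrade k.+2 U -> unitrade k.+1 (link x U).
Proof.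
move=> [hU eU]; split=> [B|T hT].
  by rewrite inE => /andP[xB /hU]; rewrite cardsU1 xB; lia.
rewrite -/(vol (above T (link x U))); case: (boolP (x \in T)) => xT.
  rewrite (@above_out _ (~: [set x])) //.
    by move=> B; rewrite inE => /andP[xB _]; rewrite subsetC sub1set inE.
  by apply/negP => /subsetP/(_ x xT); rewrite !inE eqxx.
have -> : above T (link x U) = link x (above (x |: T) U).
  apply/setP => C; rewrite !inE -andbA; case: (boolP (x \in C)) => //= xC.
  congr (_ && _); apply/subsetP/subsetP => h z zT.
    by move: zT; rewrite !inE => /orP[->//|/h ->]; rewrite orbT.
  have := h z; rewrite !inE zT orbT => /(_ isT); case: eqP => // e.
  by rewrite -e zT in xT.
rewrite card_link /deg (_ : [set B in _ | _] = above (x |: T) U).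
  by apply: (eU (x |: T)); rewrite cardsU1 xT hT.
apply/setP => B; rewrite !inE -andbA; congr (_ && _).
by apply/andP/idP => [[]//|h]; rewrite (subsetP h) // setU11.
Qed.

Lemma notin_link x U B : link x U = set0 -> B \in U -> x \notin B.
Proof.
by move=> h BU; apply/negP => xB; move: (in_link U xB); rewrite h BU inE.
Qed.

Lemma link_sd x U G : link x (sd U G) = sd (link x U) (link x G).
Proof. by apply/setP => C; rewrite !inE; case: (x \in C). Qed.

Lemma link_bd x S : x \notin S -> link x (bd (x |: S)) = bd S.
Proof.
move=> xS; apply/setP => C; rewrite !inE; case: (boolP (x \in C)) => xC /=.
  by apply/esym/negP => /andP[/subsetP/(_ x xC)]; rewrite (negbTE xS).
congr (_ && _).
  apply/subsetP/subsetP => h z zC.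
    move: (h z); rewrite !inE zC orbT => /(_ isT); case: eqP => // e; by rewrite -e zC in xC.
  by move: zC; rewrite !inE => /orP[->//|/h ->]; rewrite orbT.
congr (#|pred_of_set _| == 1); apply/setP => z; rewrite !inE; case: eqP => // ->.
by rewrite (negbTE xS) andbF.
Qed.

Lemma link_jbd x P Q : x \notin P -> x \notin Q -> link x (jbd (x |: P) Q) = jbd P Q.
Proof.
move=> xP xQ; apply/setP => C; rewrite !inE; case: (boolP (x \in C)) => xC /=.
  by apply/esym/negP => /andP[/subsetP/(_ x xC)]; rewrite inE (negbTE xP) (negbTE xQ).
congr [&& _, _ & _].
- apply/subsetP/subsetP => h z zC.
    move: (h z); rewrite !inE zC orbT => /(_ isT); case: eqP => // e; by rewrite -e zC in xC.
  move: zC; rewrite !inE => /orP[->//|/h]; rewrite inE => /orP[]->; by rewrite ?orbT.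
- congr (#|pred_of_set _| == 1); apply/setP => z; rewrite !inE; case: eqP => // ->.
  by rewrite (negbTE xP) andbF.
- congr (#|pred_of_set _| == 1); apply/setP => z; rewrite !inE; case: eqP => // ->.
  by rewrite (negbTE xQ) !andbF.
Qed.

Lemma link_out x N U : (forall B, B \in U -> B \subset N) -> x \notin N -> link x U = set0.
Proof.
move=> h xN; apply/setP => C; rewrite !inE; apply/negP => /andP[_ /h/subsetP/(_ x)].
by rewrite setU11 (negbTE xN) => /(_ isT).
Qed.

(** The blocks through [x] are common to [U] and [G] and cancel. Starting from the blocks of [U] off
    [x], each block of [G] off [x] lowers the volume by one if it lies in [U] and raises it by one
    otherwise. *)
Lemma card_sd_link x U G : link x U = link x G ->
  vol (sd U G) + vol (link x U) + 2 * vol ([set B in G | x \notin B] :&: U)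
  = vol U + vol [set B in G | x \notin B].
Proof.
move=> e; have := card_sd U G.
have h1 : vol _ + vol _ = vol _ := cardsID [set B : {set V} | x \in B] G.
have h2 : vol _ + vol _ = vol _ := cardsID [set B : {set V} | x \in B] (U :&: G).
have e1 : G :&: [set B : {set V} | x \in B] = [set B in G | x \in B].
  by apply/setP => B; rewrite !inE.
have e2 : U :&: G :&: [set B : {set V} | x \in B] = [set B in U | x \in B].
  apply/setP => B; rewrite !inE; case: (boolP (x \in B)) => xB; rewrite ?andbF ?andbT //.
  by rewrite -(in_link U xB) e (in_link G xB) andbb.
have e3 : G :\: [set B : {set V} | x \in B] = [set B in G | x \notin B].
  by apply/setP => B; rewrite !inE andbC.
have e4 : U :&: G :\: [set B : {set V} | x \in B] = [set B in G | x \notin B] :&: U.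
  by apply/setP => B; rewrite !inE; do 3 case: (_ \in _).
move: (card_link x U) (card_link x G); rewrite -e /deg.
rewrite e1 e3 in h1; rewrite e2 e4 in h2; lia.
Qed.

Lemma disjoint_setU1 x P Q : x \notin Q -> [disjoint P & Q] -> [disjoint x |: P & Q].
Proof.
move=> xQ dPQ; rewrite -setI_eq0 setIUl (disjoint_setI0 dPQ) setU0.
by apply/eqP/setP => z; rewrite !inE; case: eqP => // ->; rewrite (negbTE xQ).
Qed.

Lemma avoid_bd x S : x \notin S -> [set B in bd (x |: S) | x \notin B] = [set S].
Proof.
move=> xS; apply/setP => B; rewrite [LHS]inE [RHS]inE; apply/andP/eqP => [[/bdP[s _ ->]]|->].
  by rewrite !inE eqxx /= andbT negbK => /eqP <-; rewrite setU1K.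
by split=> //; apply/bdP; exists x; rewrite ?setU11 // setU1K.
Qed.

Lemma avoid_jbd x P Q B : [disjoint P & Q] -> x \notin P -> x \notin Q ->
  B \in [set B in jbd (x |: P) Q | x \notin B] <-> exists2 q, q \in Q & B = P :|: (Q :\ q).
Proof.
move=> dPQ xP xQ.
have dxPQ : [disjoint x |: P & Q] by exact: disjoint_setU1.
have eq q : q \in Q -> (x |: P :|: Q) :\: [set x; q] = P :|: Q :\ q.
  move=> qQ; apply/setP => z; rewrite !inE; case: (eqVneq z x) => [->|_] /=.
    by rewrite (negbTE xP) (negbTE xQ) andbF.
  by case: (eqVneq z q) => //= ->; rewrite (disjointFl dPQ qQ).
rewrite inE; split=> [/andP[/(jbdP _ dxPQ)[p [q [pP qQ ->]]]]|[q qQ ->]].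
  rewrite !inE eqxx /= andbT negbK => /orP[/eqP<-|/eqP e]; first by exists q; rewrite ?eq.
  by rewrite -e (negbTE xQ) in qQ.
apply/andP; split; last by rewrite !inE (negbTE xP) (negbTE xQ) andbF.
by apply/(jbdP _ dxPQ); exists x, q; rewrite setU11 eq.
Qed.

(** Of the [(#|P| + 1) * #|Q|] blocks of the join, the link at [x] accounts for [#|P| * #|Q|]. *)
Lemma card_avoid_jbd x P Q : [disjoint P & Q] -> x \notin P -> x \notin Q ->
  vol [set B in jbd (x |: P) Q | x \notin B] = #|Q|.
Proof.
move=> dPQ xP xQ.
have dxPQ : [disjoint x |: P & Q] by exact: disjoint_setU1.
have h1 : vol _ + vol _ = vol _ := cardsID [set B : {set V} | x \in B] (jbd (x |: P) Q).
have e1 : jbd (x |: P) Q :&: [set B : {set V} | x \in B] = [set B in jbd (x |: P) Q | x \in B].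
  by apply/setP => B; rewrite !inE.
have e3 : jbd (x |: P) Q :\: [set B : {set V} | x \in B] = [set B in jbd (x |: P) Q | x \notin B].
  by apply/setP => B; rewrite !inE andbC.
rewrite e1 e3 card_jbd // cardsU1 xP in h1.
have := card_link x (jbd (x |: P) Q); rewrite link_jbd // card_jbd // /deg => h2.
by move: h1; rewrite -h2 mulnDl mul1n addnC => /addIn.
Qed.

Lemma deg_cover x U : x \in cover U -> link x U != set0.
Proof.
move=> /bigcupP[B BU xB]; apply/set0Pn; exists (B :\ x); by rewrite in_link.
Qed.

Lemma sub_cover U B : B \in U -> B \subset cover U.
Proof. by move=> BU; apply: (bigcup_max B). Qed.

(** Incidences of points and blocks are counted twice: by blocks, each of size [k], and by covered
    points, each of degree at least [d]. *)
Lemma degree_count k d U : (forall B, B \in U -> #|B| = k) ->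
  (forall x, x \in cover U -> d <= vol (link x U)) -> d * #|cover U| <= k * vol U.
Proof.
move=> hU hd.
have -> : k * vol U = \sum_(B in U) #|B|.
  by rewrite (eq_bigr (fun=> k)) // sum_nat_const mulnC.
have -> : \sum_(B in U) #|B| = \sum_(B in U) \sum_(x in cover U) (x \in B : nat).
  apply: eq_bigr => B BU; rewrite -sum1_card big_mkcond [RHS]big_mkcond /=.
  apply: eq_bigr => x _; case: (boolP (x \in B)) => xB; last by case: ifP.
  by rewrite (subsetP (sub_cover BU)).
rewrite exchange_big /= mulnC -sum_nat_const leq_sum // => x /hd.
rewrite card_link /deg /vol => /leq_trans-> //.
rewrite -sum1_card big_mkcond [X in _ <= X]big_mkcond leq_sum //= => B _.
by rewrite inE; case: (B \in U); case: (x \in B).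
Qed.

End Collections.

(** * Unitrades of small support or small volume *)

Section Classification.
Variable V : finType.
Implicit Types (x y : V) (B C S T P Q N : {set V}) (U G : {set {set V}}).

Lemma exists_other P x : 1 < #|P| -> exists2 p, p \in P & p != x.
Proof.
move=> h; have /card_gt0P[p] : 0 < #|P :\ x|.
  by move: h; rewrite (cardsD1 x P); case: (x \in P) => /=; lia.
by rewrite !inE => /andP[px pP]; exists p.
Qed.

(** Applied to a link equal to [bd S], to learn that the vertex lies outside [S]: as soon as [S] has
    two points, each of them lies in some facet. *)
Lemma notin_bd x S : (forall B, B \in bd S -> x \notin B) -> 1 < #|S| -> x \notin S.
Proof.
move=> h hS; apply/negP => xS; have [s sS sx] := exists_other x hS.
have /h : S :\ s \in bd S by apply/bdP; exists s.
by rewrite !inE xS eq_sym sx.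
Qed.

Lemma notin_jbd x P Q : [disjoint P & Q] -> (forall B, B \in jbd P Q -> x \notin B) ->
  1 < #|P| -> 1 < #|Q| -> x \notin P :|: Q.
Proof.
move=> d h hP hQ; have [p pP px] := exists_other x hP.
have [q qQ qx] := exists_other x hQ.
have /h : (P :|: Q) :\: [set p; q] \in jbd P Q by apply/(jbdP _ d); exists p, q.
by rewrite in_setD in_set2 eq_sym (negbTE px) eq_sym (negbTE qx).
Qed.

Lemma link_notin x U C : C \in link x U -> x \notin C.
Proof. by rewrite inE => /andP[]. Qed.

Lemma disjoint_set2 a b S : a \notin S -> b \notin S -> [disjoint [set a; b] & S].
Proof. by move=> aS bS; apply: disjoint_setU1; rewrite ?disjoints1. Qed.

Lemma bd_facet S s : s \in S -> S :\ s \in bd S.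
Proof. by move=> sS; apply/bdP; exists s. Qed.

Lemma bd_base x S : x \notin S -> S \in bd (x |: S).
Proof. by move=> xS; rewrite -{1}(setU1K xS) bd_facet ?setU11. Qed.

(** The two simplices share only the facet [S], which cancels. Every remaining block omits one of
    the apexes and one point of [S]. *)
Lemma sd_bd a b S : a != b -> a \notin S -> b \notin S ->
  sd (bd (a |: S)) (bd (b |: S)) = jbd [set a; b] S.
Proof.
move=> ab aS bS; have d := disjoint_set2 aS bS.
have aux c e s : c != e -> c \notin S -> s \in S ->
    ([set c; e] :|: S) :\: [set c; s] = (e |: S) :\ s.
  move=> ce cS sS; apply/setP => z; rewrite !inE.
  by case: (eqVneq z c) => [->|_] //=; rewrite (negbTE ce) (negbTE cS) andbF.
have ba : b != a by rewrite eq_sym.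
have out c e s : c != e -> c \notin S -> s \in S -> ((c |: S) :\ s) \notin bd (e |: S).
  move=> ce cS sS; apply/negP => /bd_sub/subsetP/(_ c); rewrite !inE eqxx /=.
  rewrite (negbTE ce) (negbTE cS) andbT; case: eqP => [cs|_ /(_ isT)//].
  by rewrite cs sS in cS.
apply/setP => B; rewrite [LHS]inE; apply/idP/(jbdP _ d).
  have half c e : c != e -> c \notin S -> e \notin S -> B \in bd (c |: S) -> B \notin bd (e |: S) ->
      exists2 s, s \in S & B = ([set c; e] :|: S) :\: [set e; s].
    move=> ce cS eS /bdP[s]; rewrite in_setU1 => /orP[/eqP->|sS] ->.
      by rewrite setU1K // => /negP[]; apply: bd_base.
    by move=> _; exists s => //; rewrite setUC (setUC [set c]) setUC aux // eq_sym.
  case: (boolP (B \in bd (a |: S))) => hA /=.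
    move=> hB; have [s sS ->] := half _ _ ab aS bS hA hB.
    by exists b, s; rewrite !inE eqxx orbT.
  move=> hB; have [s sS ->] := half _ _ ba bS aS hB hA.
  by exists a, s; rewrite !inE eqxx (setUC [set b]).
move=> [c [s [+ sS ->]]]; rewrite in_set2 => /orP[]/eqP->.
  rewrite aux // (negbTE (out _ _ _ ba bS sS)) /=.
  by apply/bdP; exists s => //; rewrite !inE sS orbT.
rewrite (setUC [set a]) aux // (negbTE (out _ _ _ ab aS sS)) addbF.
by apply/bdP; exists s => //; rewrite !inE sS orbT.
Qed.

Lemma cone_sub x S U : x \notin S -> bd S \subset link x U -> S \in U ->
  bd (x |: S) \subset U.
Proof.
move=> xS sS SU; apply/subsetP => B BS; case: (boolP (x \in B)) => xB.
  by rewrite -(in_link U xB) (subsetP sS) // -(link_bd xS) in_link.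
have : B \in [set B in bd (x |: S) | x \notin B] by rewrite inE BS.
by rewrite avoid_bd // inE => /eqP->.
Qed.

(** The cone over the link cancels all blocks through [x], and its only block off [x] is the base
    [S]. If [S] is in [U] the whole cone lies in [U] and is removed; otherwise [S] appears as a new
    block. *)
Lemma reduce_bd x S U : x \notin S -> link x U = bd S ->
  let U' := sd U (bd (x |: S)) in
  link x U' = set0 /\
  if S \in U then vol U' + #|S|.+1 = vol U /\ bd (x |: S) \subset U
  else vol U' + #|S| = (vol U).+1 /\ S \in U'.
Proof.
move=> xS e /=; split.
  by rewrite link_sd link_bd // e; apply/setP => C; rewrite !inE addbb.
have := @card_sd_link _ x U (bd (x |: S)); rewrite avoid_bd // link_bd // => /(_ e).
rewrite /vol cards1 -!/(vol _) e card_bd; case: (boolP (S \in U)) => SU.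
  rewrite (setIidPl _) ?sub1set // /vol cards1 -!/(vol _); split; first lia.
  by apply: cone_sub => //; rewrite e.
rewrite (_ : _ :&: _ = set0); last first.
  by apply/setP => B; rewrite !inE; case: eqP => // ->; rewrite (negbTE SU).
rewrite /vol cards0 -!/(vol _); split; first lia.
by rewrite inE (negbTE SU) bd_base.
Qed.

Lemma exists_above k U B b : unitrade k U -> B \in U -> b \in B ->
  exists2 B', B' \in U & (B :\ b \subset B') /\ B' != B.
Proof.
move=> [hU eU] BU bB; have := eU (B :\ b); have := hU B BU.
rewrite (cardsD1 b B) bB => <- /(_ erefl); rewrite -/(above _ _) (cardsD1 B) inE BU subD1set /=.
case: (set_0Vmem (above (B :\ b) U :\ B)) => [->|[B']]; first by rewrite cards0.
by rewrite !inE => /and3P[h1 h2 h3] _; exists B'.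
Qed.

(** All blocks are facets of the support, and a set two points short of the support lies in exactly
    two facets. Evenness therefore spreads membership from one facet to every other. *)
Lemma small_cover_bd k U : unitrade k.+1 U -> #|cover U| <= k.+2 -> U != set0 ->
  exists2 S : {set V}, #|S| = k.+2 & U = bd S.
Proof.
move=> tU cU /set0Pn[B BU]; have [hU eU] := tU.
have [b bB] : exists b, b \in B by apply/card_gt0P; rewrite hU.
have [B' B'U [_ nB]] := exists_above tU BU bB.
(* Two distinct blocks of size [k.+1] already need [k.+2] points. *)
have cS : #|cover U| = k.+2.
  apply/eqP; rewrite eqn_leq cU -(hU _ BU); apply: proper_card.
  rewrite properEneq sub_cover // andbT; apply: contra nB => /eqP e.
  by rewrite eqEcard !hU // leqnn andbT e sub_cover.
exists (cover U) => //; have sub : U \subset bd (cover U).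
  apply/subsetP => C CU; rewrite inE sub_cover //=.
  by have := cardsDsub (sub_cover CU); rewrite cS (hU _ CU); lia.
apply/eqP; rewrite eqEsubset sub /=; apply/subsetP => C /bdP[s sS ->].
have /bdP[r rS eB] := subsetP sub _ BU.
case: (eqVneq s r) => [->|sr]; first by rewrite -eB.
have sB : s \in B by rewrite eB !inE sr.
have [C' C'U [sC nC]] := exists_above tU BU sB.
have /bdP[t tS eC] := subsetP sub _ C'U.
suff -> : s = t by rewrite -eC.
apply/eqP; rewrite eq_sym; apply/negPn/negP => ts.
have tr : t != r by apply: contra nC => /eqP tr; rewrite eC eB tr.
by move/subsetP: sC => /(_ t); rewrite eC eB !inE eqxx ts tr tS => /(_ isT).
Qed.

(** Complements in [N] turn blocks into the edges of a graph, and evenness says that every triangle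
    has an even number of edges. Such a graph is a cut, with the neighbourhood [D] of any point [p]
    as one side. *)
Lemma small_cover_jbd k N U : unitrade k.+1 U -> #|N| = k.+3 -> cover U \subset N ->
  exists P Q : {set V}, [/\ [disjoint P & Q], P :|: Q = N & U = jbd P Q].
Proof.
move=> tU cN sN; have [hU _] := tU.
have [p pN] : exists p, p \in N by apply/card_gt0P; rewrite cN.
pose D := [set q in N | (q != p) && (N :\: [set q; p] \in U)].
have DN : D \subset N by apply/subsetP => q; rewrite inE => /andP[].
have NE : D :|: (N :\: D) = N.
  by apply/setP => z; rewrite in_setU in_setD; case: (boolP (z \in D)) => // /(subsetP DN).
have d : [disjoint D & N :\: D].
  by rewrite -setI_eq0; apply/eqP/setP => z; rewrite in_setI in_setD in_set0; case: (z \in D).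
exists D, (N :\: D); split=> //; apply: sd_eq0; apply/eqP/set0Pn => -[B BZ].
have tZ : unitrade k.+1 (sd U (jbd D (N :\: D))).
  by apply: unitrade_sd => //; apply: unitrade_jbd => //; rewrite addnC cardsDsub.
have sZ C : C \in sd U (jbd D (N :\: D)) -> C \subset N.
  rewrite inE; case: (boolP (C \in U)) => [/sub_cover h _|_ /jbd_sub]; last by rewrite NE.
  exact: subset_trans h sN.
(* The choice of [D] makes [U] and the cut agree on the blocks that avoid [p]. *)
have pZ C : C \in sd U (jbd D (N :\: D)) -> p \in C.
  move=> CZ; apply/negPn/negP => pC; have CN := sZ _ CZ.
  have /eqP/cards2P[q [r [qr eq]]] : #|N :\: C| = 2.
    by have := cardsDsub CN; rewrite cN (tZ.1 _ CZ); lia.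
  have [{r qr eq} q [qp qN eC]] : exists q, [/\ q != p, q \in N & C = N :\: [set q; p]].
    have eC : C = N :\: [set q; r] by rewrite -eq setDDr setDv set0U; apply/esym/setIidPr.
    have qN : q \in N :\: C by rewrite eq !inE eqxx.
    have rN : r \in N :\: C by rewrite eq !inE eqxx orbT.
    move: qN rN; rewrite !inE => /andP[_ qN] /andP[_ rN].
    have : p \in N :\: C by rewrite inE pC.
    rewrite eq !inE => /orP[]/eqP->; last by exists q.
    by exists r; rewrite eq_sym setUC.
  have CD : (C \in U) = (q \in D) by rewrite inE qN qp -eC.
  have pD : p \notin D by rewrite inE eqxx andbF.
  move: CZ; rewrite inE CD; suff -> : (C \in jbd D (N :\: D)) = (q \in D) by rewrite addbb.
  apply/(jbdP _ d)/idP => [[q' [r' [q'D r'D]]]|qD]; last first.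
    by exists q, p; rewrite NE; split=> //; rewrite in_setD pD.
  rewrite NE eC => e; have : p \notin N :\: [set q'; r'] by rewrite -e !inE eqxx orbT.
  have : q \notin N :\: [set q'; r'] by rewrite -e !inE eqxx.
  rewrite !in_setD !in_set2 pN qN !andbT !negbK => /orP[/eqP->//|/eqP eqr] /orP[]/eqP ep.
    by rewrite ep q'D in pD.
  by rewrite eqr ep eqxx in qp.
(* A unitrade with all blocks through [p] is empty: a second block above [B :\ p] would contain [p]
   and hence equal [B]. *)
have [C CZ [sC nC]] := exists_above tZ BZ (pZ _ BZ).
case/negP: nC; rewrite eq_sym eqEcard !tZ.1 // leqnn andbT.
by rewrite -(setD1K (pZ _ BZ)) subUset sub1set pZ.
Qed.

Lemma small_cover k U : unitrade k.+1 U -> #|cover U| <= k.+3 -> U != set0 ->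
  (exists2 S : {set V}, #|S| = k.+2 & U = bd S) \/
  exists P Q : {set V}, [/\ [disjoint P & Q], #|P| + #|Q| = k.+3 & U = jbd P Q].
Proof.
move=> tU; rewrite leq_eqVlt ltnS => /orP[/eqP cU|cU] U0; last first.
  by left; apply: small_cover_bd.
right; have [P [Q [d e ->]]] := small_cover_jbd tU cU (subxx _); exists P, Q; split=> //.
by rewrite -cU -e cardsU (disjoint_setI0 d) cards0 subn0.
Qed.

(* A vertex of degree [k.+1] has a minimal link and can be removed; if there is none,
   the degrees force the support down to [k.+2] points. *)
Lemma unitrade_small k U : unitrade k.+1 U -> U != set0 ->
  [\/ exists2 S : {set V}, #|S| = k.+2 & U = bd S,
      0 < k /\ exists (a b : V) (M : {set V}), [/\ a != b, a \notin M, b \notin M, #|M| = k.+1 &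
                             U = jbd [set a; b] M]
    | 2 * k.+1 < vol U].
Proof.
elim: k U => [|k IHk] U.
  move=> tU U0; have [c2|c2] := leqP (vol U) 2; last by constructor 3.
  constructor 1; apply: small_cover_bd => //; rewrite /cover.
  have [hU _] := tU.
  apply: leq_trans (leq_card_cover U) _.
  by rewrite (eq_bigr (fun=> 1)) // sum1_card.
move: {2}(vol U) (leqnn (vol U)) => n; elim: n U => [|n IHn] U.
  by rewrite leqn0 /vol cards_eq0 => ->.
move=> cn tU U0; have [c2|c2] := leqP (vol U) (2 * k.+2); last by constructor 3.
have [hU _] := tU.
case: (boolP [exists x in cover U, vol (link x U) == k.+2]) => [/exists_inP[x xU /eqP cx]|hx].
  have tx := unitrade_link x tU.
  have [S cS eS] : exists2 S : {set V}, #|S| = k.+2 & link x U = bd S.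
    case: (IHk _ tx (deg_cover xU)) => [//|[k0 [a [b [M [ab aM bM cM e]]]]]|]; last by rewrite cx; lia.
    by move: cx; rewrite e card_jbd ?disjoint_set2 // cards2 ab cM; lia.
  have xS : x \notin S by apply: notin_bd; rewrite ?cS // -eS; apply: link_notin.
  have [lx] := reduce_bd xS eS; set U' := sd U _ => hc.
  have tU' : unitrade k.+2 U'.
    by apply: unitrade_sd => //; apply: unitrade_bd => //; rewrite cardsU1 xS cS.
  have [U'0|U'0] := eqVneq U' set0.
    by constructor 1; exists (x |: S); [rewrite cardsU1 xS cS | apply: sd_eq0].
  have cn' : vol U' <= n by move: hc; case: (S \in U) => -[]; lia.
  case: (IHn U' cn' tU' U'0) => [[S' cS' eS']|[_ [a [b [M [ab aM bM cM e]]]]]|c3].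
  (* If [S] were in [U], the volume would be [2 * k.+3], beyond [c2]. So [S] is a facet of [S'] as
     well, and [U] is the sum of two cones over [S]. *)
  - move: hc; case: (boolP (S \in U)) => SU [cU].
      by move: cU; rewrite eS' card_bd cS cS'; lia.
    move=> SU'; constructor 2; split=> //.
    have := SU'; rewrite eS' => /bdP[y yS' eSS].
    have yS : y \notin S by rewrite eSS !inE eqxx.
    have eS2 : S' = y |: S by rewrite eSS setD1K.
    have yx : y != x.
      apply/eqP => e; have : x \notin S'; last by rewrite eS2 e setU11.
      apply: notin_bd; last by rewrite cS'.
      by rewrite -eS' => B; apply: notin_link.
    exists y, x, S; split=> //; rewrite -sd_bd // -eS2 -eS'.
    by rewrite sdK.
  - by move: hc; rewrite e card_jbd ?disjoint_set2 // cards2 ab cM cS; case: (S \in U) => -[]; lia.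
  - by move: hc; rewrite cS; case: (S \in U) => -[]; lia.
constructor 1; apply: small_cover_bd => //.
(* For [k = 0] the value [2 * k.+1] is just the excluded volume [k.+2], and a degree bound of 2
   would still allow four points; the term [k.+3] settles that case. *)
have hd x : x \in cover U -> maxn k.+3 (2 * k.+1) <= vol (link x U).
  move=> xU; have tx := unitrade_link x tU.
  have nx : vol (link x U) != k.+2 by apply: contra hx => h; apply/exists_inP; exists x.
  case: (IHk _ tx (deg_cover xU)) => [[S cS e]|[k0 [a [b [M [ab aM bM cM e]]]]]|]; last first.
  - by move: nx; lia.
  - by move: nx; rewrite e card_jbd ?disjoint_set2 // cards2 ab cM; lia.
  - by move: nx; rewrite e card_bd cS eqxx.
have := degree_count hU hd; clear -c2; move: #|cover U| (vol U) c2 => m u; nia.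
Qed.
End Classification.

(** * The possible shapes of a 5-unitrade of volume 16 *)

Section Sixteen.
Variable V : finType.
Implicit Types (x y : V) (B C S T P Q N : {set V}) (U G Z : {set {set V}}).

Lemma vol_gt0 U : (0 < vol U) = (U != set0).
Proof. by rewrite /vol card_gt0. Qed.

Lemma unitrade_vol k U : unitrade k.+1 U -> U != set0 ->
  [\/ vol U = k.+2, vol U = 2 * k.+1 | 2 * k.+1 < vol U].
Proof.
move=> tU U0; case: (unitrade_small tU U0) => [[S cS ->]|[_ [a [b [M [ab aM bM cM ->]]]]]|].
- by constructor 1; rewrite card_bd.
- by constructor 2; rewrite card_jbd ?disjoint_set2 // cards2 ab cM.
- by constructor 3.
Qed.

Lemma unitrade_min k U : unitrade k.+1 U -> vol U = k.+2 ->
  exists2 S : {set V}, #|S| = k.+2 & U = bd S.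
Proof.
move=> tU cU; have U0 : U != set0 by rewrite -vol_gt0 cU.
case: (unitrade_small tU U0) => [//|[k0 [a [b [M [ab aM bM cM e]]]]]|]; last by lia.
by move: cU; rewrite e card_jbd ?disjoint_set2 // cards2 ab cM; lia.
Qed.

Lemma link_min k x U : unitrade k.+2 U -> vol (link x U) = k.+2 ->
  exists S : {set V}, [/\ #|S| = k.+2, x \notin S & link x U = bd S].
Proof.
move=> tU cx; have [S cS e] := unitrade_min (unitrade_link x tU) cx.
by exists S; split=> //; apply: notin_bd; rewrite ?cS // -e; apply: link_notin.
Qed.

Lemma unitrade_cone k x S : #|S| = k.+1 -> x \notin S -> unitrade k.+1 (bd (x |: S)).
Proof. by move=> cS xS; apply: unitrade_bd => //; rewrite cardsU1 xS cS. Qed.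

Lemma vol_sub_sd U Z : Z \subset U -> vol (sd U Z) + vol Z = vol U.
Proof. by move=> h; rewrite sd_subset // /vol cardsDsub. Qed.

Lemma large_links k U : unitrade k.+2 U ->
  ~~ [exists x in cover U, vol (link x U) == k.+2] ->
  forall x, x \in cover U -> 2 * k.+1 <= vol (link x U).
Proof.
move=> tU hx x xU.
have nx : vol (link x U) != k.+2 by apply: contra hx => h; apply/exists_inP; exists x.
by case: (unitrade_vol (unitrade_link x tU) (deg_cover xU)); move: nx; lia.
Qed.

(** Beyond the small cases the volume is 9 or 10. A minimal link then splits off a boundary of
    volume 5; without one all degrees are at least 6, which leaves six points and the join of type
    (3,3). *)
Lemma unitrade4_classif U : unitrade 4 U -> U != set0 -> vol U <= 10 ->
  [\/ exists2 S : {set V}, #|S| = 5 & U = bd S,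
      exists P Q : {set V}, [/\ [disjoint P & Q], #|P| + #|Q| = 6, 1 < #|Q| < 4 & U = jbd P Q]
    | exists S1 S2 : {set V}, [/\ #|S1| = 5 /\ #|S2| = 5, vol U = 10, U = sd (bd S1) (bd S2),
        bd S1 \subset U & bd S2 \subset U]].
Proof.
move=> tU U0 cU; case: (unitrade_small tU U0) => [h|[_ [a [b [M [ab aM bM cM e]]]]]|c9].
- by constructor 1.
- constructor 2; exists M, [set a; b]; rewrite jbdC disjoint_sym disjoint_set2 //.
  by rewrite cards2 ab cM.
have [hU _] := tU.
case: (boolP [exists x in cover U, vol (link x U) == 4]) => [/exists_inP[x xU /eqP cx]|hx].
  have [S [cS xS eS]] := link_min tU cx.
  have tS := unitrade_cone cS xS.
  have [_] := reduce_bd xS eS; set U' := sd U _; rewrite cS.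
  have tU' : unitrade 4 U' by apply: unitrade_sd.
  have [U'0|U'0] := eqVneq U' set0.
    by rewrite U'0 inE {1}/vol cards0; case: (S \in U) => -[]; lia.
  (* With [S] outside [U] the remainder would have volume 6 or 7, strictly between the two smallest
     volumes 5 and 8 of rank 4. *)
  case: (boolP (S \in U)) => SU [c' h]; last first.
    by case: (unitrade_vol tU' U'0); lia.
  have c5 : vol U' = 5 by case: (unitrade_vol tU' U'0); lia.
  have [S2 cS2 e2] := unitrade_min tU' c5.
  constructor 3; exists (x |: S), S2.
  have eU : U = sd (bd (x |: S)) (bd S2) by rewrite -e2 sdC sdK.
  rewrite cardsU1 xS cS; split=> //; first by lia.
  by rewrite -e2 /U' sd_subset // subsetDl.
have := degree_count hU (large_links tU hx) => hc.
have c6 : #|cover U| <= 6 by lia.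
case: (small_cover tU c6 U0) => [|[P [Q [d cPQ e]]]]; first by constructor 1.
constructor 2; exists P, Q; split=> //.
move: cU c9; rewrite e card_jbd //; move: #|P| #|Q| cPQ => p q cPQ.
by have -> : p = 6 - q by [lia]; case: q cPQ => [|[|[|[|[|[|[|]]]]]]] //; lia.
Qed.

(** At a minimal link either the cone lies in [U], or adding it would leave volume 8, strictly
    between 6 and 10. Without a minimal link all degrees are at least 8, so there are at most 60 / 8
    < 8 points. *)
Lemma unitrade5_12 U : unitrade 5 U -> vol U = 12 ->
  (exists2 Z, unitrade 5 Z /\ vol Z = 6 & Z \subset U) \/
  exists P Q : {set V}, [/\ [disjoint P & Q], #|P| = 3, #|Q| = 4 & U = jbd P Q].
Proof.
move=> tU cU; have U0 : U != set0 by rewrite -vol_gt0 cU.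
have [hU _] := tU.
case: (boolP [exists x in cover U, vol (link x U) == 5]) => [/exists_inP[x xU /eqP cx]|hx].
  have [S [cS xS eS]] := link_min tU cx.
  have tS := unitrade_cone cS xS.
  have [_] := reduce_bd xS eS; set U' := sd U _; rewrite cS.
  have tU' : unitrade 5 U' by apply: unitrade_sd.
  case: (boolP (S \in U)) => SU [c' h].
    by left; exists (bd (x |: S)) => //; rewrite card_bd cardsU1 xS cS.
  have U'0 : U' != set0 by rewrite -vol_gt0; lia.
  by case: (unitrade_vol tU' U'0); lia.
have := degree_count hU (large_links tU hx) => hc.
have c7 : #|cover U| <= 7 by lia.
case: (small_cover tU c7 U0) => [[S cS e]|[P [Q [d cPQ e]]]].
  by move: cU; rewrite e card_bd cS.
right; move: cU; rewrite e card_jbd // => cU.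
have [h|h] : #|P| = 3 \/ #|P| = 4.
  move: #|P| #|Q| cPQ cU => p q cPQ; have -> : q = 7 - p by [lia].
  by case: p cPQ => [|[|[|[|[|[|[|[|]]]]]]]]; lia.
- by exists P, Q; split=> //; lia.
- by exists Q, P; rewrite disjoint_sym jbdC; split=> //; lia.
Qed.

(** For [U] of volume 16 the complement of [Z] has the other of the two volumes 6 and 10, so this is
    kind 1 with its parts not yet identified. *)
Definition splits U :=
  exists2 Z, unitrade 5 Z /\ (vol Z = 6 \/ vol Z = 10) & Z \subset U.

(** The join has 12 blocks and the simplex 6, and they share only [S]: 12 + 6 - 2 = 16. *)
Definition formE U := exists x P Q S,
  [/\ [disjoint P & Q], #|P| = 3 /\ #|Q| = 4, x \notin P :|: Q, S \in jbd P Q &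
      U = sd (jbd P Q) (bd (x |: S))].

(** The blocks avoiding both [x] and [y] cancel, so this is the join of the boundaries of
    [[set x; y]], [P] and [Q], with 2 * 4 * 2 = 16 blocks. *)
Definition formF U := exists x y P Q,
  [/\ [disjoint P & Q], #|P| = 4 /\ #|Q| = 2, x != y, x \notin P :|: Q /\ y \notin P :|: Q &
      U = sd (jbd (x |: P) Q) (jbd (y |: P) Q)].

Lemma link_bd_forms U x S : unitrade 5 U -> vol U = 16 -> #|S| = 5 -> link x U = bd S ->
  splits U \/ formE U.
Proof.
move=> tU cU cS eS.
have xS : x \notin S by apply: notin_bd; rewrite ?cS // -eS; apply: link_notin.
have tS := unitrade_cone cS xS.
have [lx] := reduce_bd xS eS; set U' := sd U _; rewrite cS.
have tU' : unitrade 5 U' by apply: unitrade_sd.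
case: (boolP (S \in U)) => SU [c' h].
  by left; exists (bd (x |: S)) => //; rewrite card_bd cardsU1 xS cS; split=> //; left.
have c12 : vol U' = 12 by lia.
case: (unitrade5_12 tU' c12) => [[Z [tZ cZ] sZ]|[P [Q [d cP cQ e]]]]; last first.
  right; exists x, P, Q, S; split=> //; last by rewrite -e sdK.
    by apply: notin_jbd; rewrite ?cP ?cQ // -e => B; apply: notin_link.
  by rewrite -e.
(* The only block of [U'] that may be missing from [U] is [S]. If [Z] contains it, the complement of
   [Z] in [U'] has volume 6 too and avoids it. *)
left; wlog SZ : Z tZ cZ sZ / S \notin Z.
  move=> hw; case: (boolP (S \in Z)) => SZ; last exact: (hw Z).
  apply: (hw (sd U' Z)); first exact: unitrade_sd.
  - by have := vol_sub_sd sZ; lia.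
  - by rewrite sd_subset // subsetDl.
  - by rewrite sd_subset // inE SZ.
exists Z; first by split=> //; left.
apply/subsetP => B BZ; have BU' := subsetP sZ _ BZ.
have xB := notin_link lx BU'.
move: BU'; rewrite /U' in_set; case: (boolP (B \in bd _)) => [Bbd|]; last by rewrite addbF.
have : B \in [set B in bd (x |: S) | x \notin B] by rewrite inE Bbd.
by rewrite avoid_bd // inE => /eqP e; rewrite e (negbTE SZ) in BZ.
Qed.

Lemma link_sd_out N x U G : (forall B, B \in G -> B \subset N) -> x \notin N ->
  link x U = link x (sd U G).
Proof.
by move=> h xN; rewrite link_sd (link_out h xN); apply/setP => C; rewrite !inE addbF.
Qed.

Lemma link_jbd2 (a b : V) (M : {set V}) : a != b -> a \notin M -> b \notin M ->
  link a (jbd [set a; b] M) = bd M.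
Proof. by move=> ab aM bM; rewrite link_jbd ?inE // jbd1. Qed.

Lemma link_jbd_forms U x P Q : unitrade 5 U -> vol U = 16 -> [disjoint P & Q] ->
  #|P| + #|Q| = 6 -> 1 < #|Q| < 4 -> link x U = jbd P Q ->
  [\/ splits U, formE U | formF U].
Proof.
move=> tU cU d cPQ cQ eL.
(* The second shape is reached through some other point [y] whose link is a simplex boundary. *)
suff main : [\/ splits U, exists y S, #|S| = 5 /\ link y U = bd S | formF U].
  case: main => [h|[y [S [cS h]]]|h]; [by constructor 1| |by constructor 3].
  by case: (link_bd_forms tU cU cS h) => h'; [constructor 1 | constructor 2].
have : x \notin P :|: Q.
  by apply: notin_jbd; rewrite -?eL; try (by apply: link_notin); lia.
rewrite in_setU negb_or => /andP[xP xQ].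
have dx : [disjoint x |: P & Q] by apply: disjoint_setU1.
set G := jbd (x |: P) Q.
have tG : unitrade 5 G by apply: unitrade_jbd => //; rewrite cardsU1 xP; lia.
have lG : link x U = link x G by rewrite link_jbd.
set Z := sd U G; have tZ : unitrade 5 Z by apply: unitrade_sd.
pose A0 := [set B in G | x \notin B].
have cA0 : vol A0 = #|Q| by apply: card_avoid_jbd.
have A0P B : B \in A0 <-> exists2 q, q \in Q & B = P :|: (Q :\ q) by apply: avoid_jbd.
have cL : vol (link x U) = #|P| * #|Q| by rewrite eL card_jbd.
have := card_sd_link lG; rewrite -/A0 -/Z cA0 cU cL => cZ.
have iA : vol (A0 :&: U) <= #|Q| by rewrite -cA0 /vol subset_leq_card // subsetIl.
(* Types (4,2) and (3,3) give the same constant: 16 + 2 - 8 = 16 + 3 - 9 = 10. *)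
have cZ' : vol Z + 2 * vol (A0 :&: U) = 10.
  by case: #|Q| #|P| cPQ cQ cZ => [|[|[|[|?]]]] // p *; lia.
clear cZ cL; have Z0 : Z != set0 by rewrite -vol_gt0; lia.
have lZ : link x Z = set0 by rewrite link_sd lG; apply/setP => B; rewrite !inE addbb.
have GN B : B \in G -> B \subset x |: (P :|: Q) by move/jbd_sub; rewrite setUA.
have A0G B : B \in A0 -> B \in G by rewrite inE => /andP[].
case: (unitrade_small tZ Z0) => [[Y cY eY]|[_ [a [b [M [ab aM bM cM eZ]]]]]|]; last by lia.
  have i2 : vol (A0 :&: U) = 2 by move: cZ'; rewrite eY card_bd; lia.
  have [q2|q3] : #|Q| = 2 \/ #|Q| = 3 by lia.
    constructor 1; exists G; first by split=> //; right; rewrite card_jbd // cardsU1 xP; lia.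
    have /setIidPl sA : A0 :&: U = A0.
      by apply/eqP; rewrite eqEcard subsetIl /= -/(vol A0) -/(vol (A0 :&: U)); lia.
    apply/subsetP => B BG; case: (boolP (x \in B)) => xB.
      by rewrite -(in_link U xB) lG in_link.
    by apply: (subsetP sA); rewrite inE BG.
  (* Two of the three blocks of [A0] lie in [U]. The third, [B0], is then a facet of [Y], and the
     point [y] of [Y] opposite to it turns out to lie outside the support of [G]. *)
  have [B0 B0A B0U] : exists2 B0, B0 \in A0 & B0 \notin U.
    apply/subsetPn; apply/negP => /setIidPl e; move: i2; rewrite e cA0; lia.
  have [B1] : exists B1, B1 \in A0 :&: U by apply/card_gt0P; rewrite -/(vol _) i2.
  rewrite in_setI => /andP[B1A B1U].
  have B0Z : B0 \in bd Y by rewrite -eY in_set (negbTE B0U) A0G.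
  have B1Z : B1 \notin bd Y by rewrite -eY in_set B1U A0G.
  have xY : x \notin Y by apply: notin_bd; rewrite ?cY // -eY => B; apply: notin_link.
  have /bdP[y yY eB0] := B0Z.
  have yB0 : y \notin B0 by rewrite eB0 !inE eqxx.
  have eYy : Y = y |: B0 by rewrite eB0 setD1K.
  constructor 2; exists y, B0; split; first by apply: (tZ.1); rewrite eY.
  rewrite (link_sd_out _ GN) -/Z ?eY ?eYy ?link_bd //.
  rewrite in_setU1 negb_or; apply/andP; split; first by apply: contraNneq xY => <-.
  (* Otherwise [Y] is [P :|: Q], which has every block of [A0] as a facet, [B1] included. *)
  apply/negP => yPQ; case/negP: B1Z.
  have /A0P[q0 q0Q eq0] := B0A; have /A0P[q1 q1Q eq1] := B1A.
  have q0P : q0 \notin P by rewrite (disjointFl d q0Q).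
  have q1P : q1 \notin P by rewrite (disjointFl d q1Q).
  have yq0 : y = q0.
    move: yPQ yB0; rewrite eq0 !inE; case: (y \in P) => //= ->.
    by rewrite andbT negbK => /eqP.
  have YE : Y = P :|: Q.
    rewrite eYy eq0 yq0; apply/setP => z; rewrite !inE.
    by case: (eqVneq z q0) => //= ->; rewrite q0Q orbT.
  apply/bdP; exists q1; rewrite YE ?inE ?q1Q ?orbT // eq1.
  by apply/setP => z; rewrite !inE; case: (eqVneq z q1) => //= ->; rewrite (negbTE q1P).
have cZ10 : vol Z = 10 by rewrite eZ card_jbd ?disjoint_set2 // cards2 ab cM.
have i0 : vol (A0 :&: U) = 0 by clear - cZ' cZ10; lia.
have dM : [disjoint [set a; b] & M] by apply: disjoint_set2.
have xM : x \notin [set a; b] :|: M.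
  by apply: notin_jbd; rewrite ?cM ?cards2 ?ab // -eZ => B; apply: notin_link.
have ba : b != a by rewrite eq_sym.
have aZ : link a Z = bd M by rewrite eZ link_jbd2.
have bZ : link b Z = bd M by rewrite eZ setUC link_jbd2.
move: xM; rewrite !inE !negb_or => /andP[/andP[xa xb] xM].
(* A point outside the support of [G] has the same link in [U] as in [Z], here [bd M]. *)
case: (boolP (a \in P :|: Q)) => aPQ; last first.
  constructor 2; exists a, M; split=> //.
  by rewrite (link_sd_out _ GN) // in_setU1 negb_or eq_sym xa.
case: (boolP (b \in P :|: Q)) => bPQ; last first.
  constructor 2; exists b, M; split=> //.
  by rewrite (link_sd_out _ GN) // in_setU1 negb_or eq_sym xb.
have A0Z q : q \in Q -> P :|: Q :\ q \in Z.
  move=> qQ; have qA : P :|: Q :\ q \in A0 by apply/A0P; exists q.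
  rewrite in_set A0G // addbT; apply/negP => qU.
  have : 0 < vol (A0 :&: U) by rewrite vol_gt0; apply/set0Pn; exists (P :|: Q :\ q); rewrite inE qA.
  by rewrite i0.
(* A block of [A0] omits only [q] from [P :|: Q], which contains [a] and [b]; as a block of [Z] it
   omits one of these two. *)
have sQ : Q \subset [set a; b].
  apply/subsetP => q qQ; have := A0Z q qQ; rewrite eZ in_set => /and3P[_ + _].
  rewrite in_set2; case: (eqVneq q a) => //= qa; case: (eqVneq q b) => //= qb.
  rewrite (_ : _ :\: _ = set0) ?cards0 //; apply/setP => z; rewrite in_setD in_set2 in_set0.
  case: (eqVneq z a) => [->|_] /=.
    by move: aPQ; rewrite !inE eq_sym qa /= => ->.
  case: (eqVneq z b) => [->|_] /=; last by rewrite andbF.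
  by move: bPQ; rewrite !inE eq_sym qb /= => ->.
have eQ : Q = [set a; b] by apply/eqP; rewrite eqEcard sQ cards2 ab; clear - cQ; lia.
have cQ2 : #|Q| = 2 by rewrite eQ cards2 ab.
have sP : P \subset M.
  apply/subsetP => p pP; have aQ : a \in Q by rewrite eQ !inE eqxx.
  have := A0Z a aQ; rewrite eZ -eQ => /jbd_sub/subsetP/(_ p).
  by rewrite !inE pP (disjointFr d pP) /= => /(_ isT).
have /eqP/cards1P[y ey] : #|M :\: P| = 1 by have := cardsDsub sP; clear - cPQ cQ2 cM; lia.
have : y \in M :\: P by rewrite ey set11.
rewrite in_setD => /andP[yP yM].
have eM : M = y |: P.
  rewrite -ey; apply/setP => z; rewrite in_setU in_setD.
  by case: (boolP (z \in P)) => [/(subsetP sP)->|_]; rewrite ?orbT ?orbF.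
constructor 3; exists x, y, P, Q; split=> //.
- by clear - cPQ cQ2; lia.
- by apply: contraNneq xM => ->.
- by rewrite !in_setU (negbTE xP) (negbTE xQ) (negbTE yP) eQ (disjointFl dM yM).
- have <- : Z = jbd (y |: P) Q by rewrite eZ eM eQ jbdC.
  by rewrite -/G (sdC G Z) /Z sdK.
Qed.

(** If neither base is in [U], adding both cones removes 10 blocks and creates the two bases. The
    result would have volume 8, which no 5-unitrade has. *)
Lemma link_bd2_splits U x S1 S2 : unitrade 5 U -> vol U = 16 -> #|S1| = 5 -> #|S2| = 5 ->
  vol (link x U) = 10 -> link x U = sd (bd S1) (bd S2) ->
  bd S1 \subset link x U -> bd S2 \subset link x U -> splits U.
Proof.
move=> tU cU c1 c2 cL eL s1 s2.
have x1 : x \notin S1.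
  by apply: notin_bd; rewrite ?c1 // => B /(subsetP s1); apply: link_notin.
have x2 : x \notin S2.
  by apply: notin_bd; rewrite ?c2 // => B /(subsetP s2); apply: link_notin.
have case1 S : #|S| = 5 -> x \notin S -> bd S \subset link x U -> S \in U -> splits U.
  move=> cS xS sS SU; exists (bd (x |: S)); last exact: cone_sub.
  by rewrite card_bd cardsU1 xS cS; split; [apply: unitrade_cone | left].
case: (boolP (S1 \in U)) => S1U; first exact: (case1 S1).
case: (boolP (S2 \in U)) => S2U; first exact: (case1 S2).
have n12 : S1 != S2.
  apply/eqP => e; move: cL; rewrite eL e (_ : sd _ _ = set0) ?/vol ?cards0 //.
  by apply/setP => B; rewrite !inE addbb.
pose G := sd (bd (x |: S1)) (bd (x |: S2)).
have tG : unitrade 5 G by apply: unitrade_sd; apply: unitrade_cone.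
have lG : link x U = link x G by rewrite link_sd !link_bd.
have AE : [set B in G | x \notin B] = [set S1; S2].
  have -> : [set B in G | x \notin B] =
      sd [set B in bd (x |: S1) | x \notin B] [set B in bd (x |: S2) | x \notin B].
    by apply/setP => B; rewrite !inE; case: (x \in B); rewrite ?andbF ?andbT.
  rewrite !avoid_bd //; apply/setP => B; rewrite !inE.
  by case: (eqVneq B S1) => [->|]; rewrite ?(negbTE n12).
have := card_sd_link lG; rewrite AE cL cU.
rewrite (_ : _ :&: U = set0); last first.
  apply/setP => B; rewrite !inE; case: (eqVneq B S1) => [->|_] /=; first by rewrite (negbTE S1U).
  by case: (eqVneq B S2) => [->|_] //=; rewrite (negbTE S2U).
rewrite {2 3}/vol cards0 cards2 n12 /= => c8.
have tZ : unitrade 5 (sd U G) by apply: unitrade_sd.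
have Z0 : sd U G != set0 by rewrite -vol_gt0; lia.
by case: (unitrade_vol tZ Z0); lia.
Qed.

Lemma unitrade5_16 U : unitrade 5 U -> vol U = 16 -> [\/ splits U, formE U | formF U].
Proof.
move=> tU cU; have U0 : U != set0 by rewrite -vol_gt0 cU.
have [hU _] := tU.
(* Degrees of at least 11 leave at most 80 / 11 < 8 points. The volume is then 6 or a product of two
   numbers with sum 7, never 16. *)
have [x xU cx] : exists2 x, x \in cover U & vol (link x U) <= 10.
  case: (boolP [exists x in cover U, vol (link x U) <= 10]) => [/exists_inP//|].
  rewrite negb_exists_in => /forall_inP h.
  have hd x : x \in cover U -> 11 <= vol (link x U) by move/h; rewrite -ltnNge.
  have hc := degree_count hU hd.
  have c7 : #|cover U| <= 7 by lia.
  case: (small_cover tU c7 U0) => [[S cS e]|[P [Q [d cPQ e]]]].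
    by move: cU; rewrite e card_bd cS.
  move: cU; rewrite e card_jbd //; move: #|P| #|Q| cPQ => p q cPQ.
  have -> : q = 7 - p by [lia].
  by case: p cPQ => [|[|[|[|[|[|[|[|]]]]]]]]; lia.
case: (unitrade4_classif (unitrade_link x tU) (deg_cover xU) cx).
- move=> [S cS e]; case: (link_bd_forms tU cU cS e) => h; [by constructor 1 | by constructor 2].
- by move=> [P [Q [d cPQ cQ e]]]; apply: link_jbd_forms e.
- move=> [S1 [S2 [[c1 c2] cL eL s1 s2]]]; constructor 1.
  exact: (link_bd2_splits tU cU c1 c2 cL eL s1 s2).
Qed.

End Sixteen.

(** * Images of collections under an injection of points *)

Section Transport.
Variables (T V : finType) (f : T -> V).
Hypothesis f_inj : injective f.
Implicit Types (A B P Q S : {set T}) (U G : {set {set T}}).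

Definition push (U : {set {set T}}) : {set {set V}} := (fun u : {set T} => f @: u) @: U.

Lemma imset_diff A B : f @: (A :\: B) = (f @: A) :\: (f @: B).
Proof.
apply/setP => y; rewrite inE; apply/imsetP/andP => [[x]|[yB /imsetP[x xA e]]].
  by rewrite inE => /andP[xB xA] ->; rewrite !mem_imset.
by exists x => //; rewrite inE xA andbT; apply: contra yB => xB; rewrite e mem_imset.
Qed.

Lemma push_sd U G : push (sd U G) = sd (push U) (push G).
Proof.
have g_inj := imset_inj f_inj.
apply/setP => B; case: (boolP (B \in (fun u : {set T} => f @: u) @: setT)).
  by move=> /imsetP[C _ ->]; rewrite in_set !mem_imset // in_set.
move=> h; have out X : (B \in push X) = false.
  by apply/negP => /imsetP[C _ e]; case/negP: h; rewrite e imset_f.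
by rewrite in_set !out.
Qed.

Lemma push_bd S : push (bd S) = bd (f @: S).
Proof.
apply/setP => B; apply/imsetP/bdP => [[C /bdP[s sS ->] ->]|[y /imsetP[s sS ->] ->]].
  by exists (f s); rewrite ?imset_f // imset_diff imset_set1.
by exists (S :\ s); rewrite ?bd_facet // imset_diff imset_set1.
Qed.

Lemma push_jbd P Q : [disjoint P & Q] -> push (jbd P Q) = jbd (f @: P) (f @: Q).
Proof.
move=> d; have fd : [disjoint f @: P & f @: Q].
  rewrite -setI_eq0 -imsetI; first by rewrite (disjoint_setI0 d) imset0.
  by move=> x y _ _; apply: f_inj.
have e p q : f @: ((P :|: Q) :\: [set p; q]) = (f @: P :|: f @: Q) :\: [set f p; f q].
  by rewrite imset_diff !imsetU !imset_set1.
apply/setP => B; apply/imsetP/(jbdP _ fd) => [[C /(jbdP _ d)[p [q [pP qQ ->]]] ->]|].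
  by exists (f p), (f q); rewrite !imset_f // e.
move=> [_ [_ [/imsetP[p pP ->] /imsetP[q qQ ->] ->]]].
by exists ((P :|: Q) :\: [set p; q]); rewrite ?e //; apply/(jbdP _ d); exists p, q.
Qed.

Lemma vol_push U : vol (push U) = vol U.
Proof. by rewrite /vol card_imset //; apply: imset_inj. Qed.

Lemma deg_push U i : deg (f i) (push U) = deg i U.
Proof.
rewrite /deg -(vol_push [set B in U | i \in B]); congr vol.
apply/setP => B; rewrite in_set; apply/andP/imsetP => [[/imsetP[C CU ->]]|[C]].
  by rewrite mem_imset // => iC; exists C; rewrite ?inE ?CU.
rewrite inE => /andP[CU iC] ->; split; last by rewrite mem_imset.
exact: (imset_f (fun u : {set T} => f @: u)).
Qed.

Lemma deg_push_cases U v : deg v (push U) = 0 \/ exists i, deg v (push U) = deg i U.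
Proof.
case: (boolP (v \in f @: setT)) => [/imsetP[i _ ->]|h]; first by right; exists i; apply: deg_push.
left; rewrite /deg (_ : [set _ in _ | _] = set0) ?/vol ?cards0 //.
apply/setP => B; rewrite in_set in_set0; apply/negP => /andP[/imsetP[C _ ->] /imsetP[i _ e]].
by case/negP: h; rewrite e imset_f.
Qed.

End Transport.

(** * Collections given by lists of labels, and their evaluation *)

(** Labels start at 1 and positions in [s] at 0, hence [j.-1]. With [s] an enumeration of the
    points, the image of a listed block becomes an explicit list of points. *)
Lemma blk_listed (V : finType) (x0 : V) (s : seq V) (n : nat) (l : seq nat) :
  all (fun j => 0 < j <= n) l ->
  (fun i : 'I_n => nth x0 s i) @: blk n l = [set x in [seq nth x0 s j.-1 | j <- l]].
Proof.
move=> /allP hl; apply/setP => y; rewrite in_set; apply/imsetP/mapP => [[i]|[j jl ->]].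
  by rewrite inE => il ->; exists i.+1.
have /andP[j0 jn] := hl j jl; have jn' : j.-1 < n by rewrite prednK.
by exists (Ordinal jn') => //; rewrite inE /= prednK.
Qed.

Lemma listing_inj (V : finType) (x0 : V) (s : seq V) (n : nat) : size s = n -> uniq s ->
  injective (fun i : 'I_n => nth x0 s i).
Proof.
move=> sz us i j /eqP; rewrite nth_uniq ?sz ?ltn_ord // => /eqP; exact: val_inj.
Qed.

Section Blocks.
Variable n : nat.
Implicit Types (l m p q : seq nat) (ls : seq (seq nat)).

Lemma blkU l m : blk n l :|: blk n m = blk n (l ++ m).
Proof. by apply/setP => i; rewrite !inE mem_cat. Qed.

Lemma blkD l m : blk n l :\: blk n m = blk n [seq j <- l | j \notin m].
Proof. by apply/setP => i; rewrite !inE mem_filter. Qed.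

Lemma card_blk l : #|blk n l| = count (mem l) (iota 1 n).
Proof.
rewrite -sum1_card -sum1_count.
have -> : iota 1 n = index_iota 1 n.+1 by rewrite /index_iota subn1.
rewrite big_add1 big_mkord.
by apply: eq_bigl => i; rewrite inE.
Qed.

(** Inclusion and omission of one point are phrased on lists of labels, where plain evaluation
    decides them. *)
Definition blk_sub l m := count (mem [seq j <- l | j \notin m]) (iota 1 n) == 0.
Definition blk_facet l m := count (mem [seq j <- m | j \notin l]) (iota 1 n) == 1.

Lemma blk_subE l m : (blk n l \subset blk n m) = blk_sub l m.
Proof. by rewrite -setD_eq0 -cards_eq0 blkD card_blk. Qed.

Lemma mem_bd_blk m l : (blk n l \in bd (blk n m)) = blk_sub l m && blk_facet l m.
Proof. by rewrite inE blk_subE blkD card_blk. Qed.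

Lemma mem_jbd_blk p q l : (blk n l \in jbd (blk n p) (blk n q)) =
  [&& blk_sub l (p ++ q), blk_facet l p & blk_facet l q].
Proof. by rewrite inE blkU blk_subE !blkD !card_blk. Qed.

Lemma disjoint_blk p q : ~~ has (mem q) p -> [disjoint blk n p & blk n q].
Proof.
move=> h; rewrite -setI_eq0; apply/eqP/setP => i; rewrite !inE; apply/negP => /andP[ip iq].
by case/negP: h; apply/hasP; exists i.+1.
Qed.

(** Each list is first put in increasing order without repetition, so that lists of the same block
    become equal. *)
Definition distinct_blks ls := uniq [seq [seq j <- iota 1 n | j \in l] | l <- ls].

Lemma card_coll ls : distinct_blks ls -> vol (coll n ls) = size ls.
Proof.
move=> h; rewrite /vol /coll cardsE -(size_map (blk n)); apply/card_uniqP.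
(* [g] recovers the normalised list from the block, so distinct normalised lists come from distinct
   blocks. *)
pose g (B : {set 'I_n}) := [seq j <- iota 1 n | [exists i : 'I_n, (i \in B) && (i.+1 == j)]].
apply: (@map_uniq _ _ g); rewrite -map_comp; move: h; rewrite /distinct_blks.
congr (is_true (uniq _)); apply: eq_map => l /=; apply: eq_in_filter => j.
rewrite mem_iota => /andP[j0 jn]; apply/idP/existsP => [jl|[i]]; last first.
  by rewrite inE => /andP[il /eqP <-].
have jn' : j.-1 < n by rewrite prednK //; rewrite add1n ltnS in jn.
by exists (Ordinal jn'); rewrite inE /= prednK // jl eqxx.
Qed.

(** An inclusion between collections of equal volume is an equality, so only the membership of the
    listed blocks has to be evaluated. *)
Lemma coll_eq ls (X : {set {set 'I_n}}) : distinct_blks ls -> vol X = size ls ->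
  all (fun l => blk n l \in X) ls -> coll n ls = X.
Proof.
move=> h cX /allP hX; apply/eqP; rewrite eqEcard -!/(vol _) card_coll // cX leqnn andbT.
by apply/subsetP => B; rewrite inE => /mapP[l ll ->]; apply: hX.
Qed.

Lemma deg_coll ls (i : 'I_n) : distinct_blks ls ->
  deg i (coll n ls) = count (fun l => i.+1 \in l) ls.
Proof.
move=> h; rewrite -size_filter -card_coll; last first.
  by apply: subseq_uniq h; rewrite map_subseq ?filter_subseq.
congr vol; apply/setP => B; rewrite in_set [in LHS]in_set [in RHS]in_set.
apply/andP/mapP => [[/mapP[l ll ->]]|[l]].
  by rewrite inE => il; exists l => //; rewrite mem_filter il.
by rewrite mem_filter => /andP[il ll] ->; rewrite map_f // inE.
Qed.

End Blocks.

Lemma W5_bd : W5 = bd [set: 'I_6].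
Proof.
apply/setP => B; rewrite !inE subsetT /=.
by have := cardsDsub (subsetT B); rewrite cardsT card_ord; move: #|_ :\: _| #|B| => a b; lia.
Qed.

Lemma R5_jbd : R5 = jbd (blk 7 [:: 6; 7]) (blk 7 [:: 1; 2; 3; 4; 5]).
Proof.
apply: coll_eq; first by vm_compute.
  by rewrite card_jbd ?disjoint_blk // !card_blk.
by rewrite /= !mem_jbd_blk; vm_compute.
Qed.

(* The volume hypothesis is supplied by the unitrade on which these collections are pushed. *)
Lemma E8_form :
  vol (sd (jbd (blk 8 [:: 5; 6; 7]) (blk 8 [:: 1; 2; 3; 4])) (bd (blk 8 [:: 8; 2; 3; 4; 6; 7]))) = 16 ->
  E8 = sd (jbd (blk 8 [:: 5; 6; 7]) (blk 8 [:: 1; 2; 3; 4])) (bd (blk 8 [:: 8; 2; 3; 4; 6; 7])).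
Proof.
move=> c; apply: coll_eq; [by vm_compute | exact: c |].
under eq_all => l do rewrite in_set mem_jbd_blk mem_bd_blk.
by vm_compute.
Qed.

Lemma F8_form :
  vol (sd (jbd (blk 8 [:: 5; 1; 2; 3; 4]) (blk 8 [:: 7; 8])) (jbd (blk 8 [:: 6; 1; 2; 3; 4]) (blk 8 [:: 7; 8]))) = 16 ->
  F8 = sd (jbd (blk 8 [:: 5; 1; 2; 3; 4]) (blk 8 [:: 7; 8])) (jbd (blk 8 [:: 6; 1; 2; 3; 4]) (blk 8 [:: 7; 8])).
Proof.
move=> c; apply: coll_eq; [by vm_compute | exact: c |].
under eq_all => l do rewrite in_set !mem_jbd_blk.
by vm_compute.
Qed.

(** * From shapes to kinds, and the degrees that separate the kinds *)

Section Kinds.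
Variable V : finType.
Implicit Types (U W R : {set {set V}}) (M P Q S : {set V}).

Lemma listing S : exists s : seq V, [/\ uniq s, size s = #|S| & S = [set z in s]].
Proof.
exists (enum S); rewrite enum_uniq -cardE; split=> //.
by apply/setP => z; rewrite inE mem_enum.
Qed.

Lemma pointed_listing S x : x \in S -> exists s : seq V,
  [/\ uniq (x :: s), (size s).+1 = #|S|, S = [set z in x :: s] & S :\ x = [set z in s]].
Proof.
move=> xS; have [s [us sz e]] := listing (S :\ x); exists s; split=> //=.
- by rewrite us andbT; have := setD11 x S; rewrite e inE => ->.
- by rewrite sz (cardsD1 x S) xS.
- by rewrite -(setD1K xS) e; apply/setP => z; rewrite !inE.
Qed.

Lemma uniq_cat_sets (s t : seq V) : uniq s -> uniq t ->
  [disjoint [set z in s] & [set z in t]] -> uniq (s ++ t).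
Proof.
move=> us ut d; rewrite cat_uniq us ut andbT; apply/hasPn => z zt.
by have := disjointFl d (x := z); rewrite !inE => ->.
Qed.

Lemma equiv_W5 S : #|S| = 6 -> equiv W5 (bd S).
Proof.
move=> cS; have [s [us sz e]] := listing S.
have [x0 _] : exists x0, x0 \in S by apply/card_gt0P; rewrite cS.
have szs : size s = 6 by rewrite sz.
have fi := listing_inj (x0 := x0) szs us.
exists (fun i : 'I_6 => nth x0 s i); split=> //.
rewrite W5_bd -/(push _ _) push_bd //; congr bd; apply/esym/eqP.
rewrite eqEcard card_imset // cardsT card_ord cS leqnn andbT.
by apply/subsetP => _ /imsetP[i _ ->]; rewrite e inE mem_nth // szs.
Qed.

Lemma equiv_R5 (a b : V) M : a != b -> a \notin M -> b \notin M -> #|M| = 5 ->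
  equiv R5 (jbd [set a; b] M).
Proof.
move=> ab aM bM cM; have [s [us sz e]] := listing M; rewrite cM in sz.
have uab : uniq [:: a; b] by rewrite /= inE ab.
have : uniq (s ++ [:: a; b]).
  apply: uniq_cat_sets => //; rewrite -e disjoint_sym (_ : [set z in _] = [set a; b]).
    exact: disjoint_set2.
  by apply/setP => z; rewrite !inE.
move: s us sz e => [|m1 [|m2 [|m3 [|m4 [|m5 [|? ?]]]]]] // _ _ -> us.
set s := _ ++ _ in us; have fi := listing_inj (x0 := a) (erefl (size s)) us.
exists (fun i : 'I_7 => nth a s i); split=> //.
rewrite R5_jbd -/(push _ _) push_jbd ?disjoint_blk // !blk_listed //=.
by congr jbd; apply/setP => z; rewrite !inE.
Qed.

(** The two smallest volumes 6 and 10 of a 5-unitrade are each attained by a single shape. *)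
Lemma kind1_of_parts W R : unitrade 5 W -> unitrade 5 R -> vol W = 6 -> vol R = 10 ->
  W :&: R = set0 -> kind1 (W :|: R).
Proof.
move=> tW tR cW cR d; have [S cS eW] := unitrade_min tW cW.
have R0 : R != set0 by rewrite -vol_gt0 cR.
exists W, R; split=> //; first by rewrite eW; apply: equiv_W5.
case: (unitrade_small tR R0) => [[S' cS' eR]|[_ [a [b [M [ab aM bM cM ->]]]]]|].
- by move: cR; rewrite eR card_bd cS'.
- exact: equiv_R5.
- by rewrite cR.
Qed.

Lemma kind1_of_splits U : unitrade 5 U -> vol U = 16 -> splits U -> kind1 U.
Proof.
move=> tU cU [Z [tZ cZ] sZ].
have tD := unitrade_sd tU tZ; have cD := vol_sub_sd sZ; rewrite cU in cD.
have e : sd U Z :|: Z = U.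
  apply/setP => B; rewrite sd_subset // in_setU in_setD.
  by case: (boolP (B \in Z)) => [/(subsetP sZ)->|_]; rewrite ?orbF.
have d : sd U Z :&: Z = set0.
  by apply/setP => B; rewrite sd_subset // in_setI in_setD in_set0; case: (B \in Z); rewrite ?andbF.
rewrite -e; case: cZ => cZ; rewrite cZ in cD; last by apply: kind1_of_parts => //; lia.
by rewrite setUC; apply: kind1_of_parts; rewrite ?(setIC Z) //; lia.
Qed.

Lemma kind2_of_formE U : vol U = 16 -> formE U -> kind2 U.
Proof.
move=> cU [x [P [Q [S [d [cP cQ] xPQ /(jbdP _ d)[p0 [q0 [p0P q0Q eS]]] eU]]]]].
have [sp [up szp eP eP']] := pointed_listing p0P.
have [sq [uq szq eQ eQ']] := pointed_listing q0Q.
have eS' : S = (P :\ p0) :|: (Q :\ q0).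
  rewrite eS; apply/setP => z; rewrite !inE.
  case: (eqVneq z p0) => [->|_] /=; first by rewrite (disjointFr d p0P) andbF.
  by case: (eqVneq z q0) => [->|_] //=; rewrite (disjointFl d q0Q).
have u1 : uniq ((q0 :: sq) ++ (p0 :: sp)).
  by apply: uniq_cat_sets => //; rewrite -eP -eQ disjoint_sym.
(* In this order labels 1 to 4 name [Q], 5 to 7 name [P] and 8 names [x]; the points [q0] and [p0]
   omitted by [S] get 1 and 5. *)
have u2 : uniq (((q0 :: sq) ++ (p0 :: sp)) ++ [:: x]).
  apply: uniq_cat_sets => //; rewrite disjoint_sym (_ : [set z in [:: x]] = [set x]).
    rewrite disjoints1 inE mem_cat; move: xPQ; rewrite in_setU negb_or => /andP[].
    by rewrite eP eQ !in_set negb_or => -> ->.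
  by apply/setP => z; rewrite !inE.
rewrite cP in szp; rewrite cQ in szq; rewrite {}eS' eP' eQ' eP eQ in eU.
clear - cU eU u2 szp szq.
move: sp sq szp szq eU u2 => [|p1 [|p2 [|? ?]]] // [|q1 [|q2 [|q3 [|? ?]]]] // _ _ eU us.
set s := _ ++ _ in us; have fi := listing_inj (x0 := x) (erefl (size s)) us.
have eUf : U = push (fun i : 'I_8 => nth x s i)
    (sd (jbd (blk 8 [:: 5; 6; 7]) (blk 8 [:: 1; 2; 3; 4])) (bd (blk 8 [:: 8; 2; 3; 4; 6; 7]))).
  rewrite eU push_sd // push_bd // push_jbd ?disjoint_blk // !blk_listed //=.
  congr sd; congr bd; apply/setP => z; rewrite !inE.
  by do 6 case: (z == _).
exists (fun i : 'I_8 => nth x s i); split=> //; rewrite E8_form //.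
by rewrite -(vol_push fi) -eUf.
Qed.

Lemma kind3_of_formF U : vol U = 16 -> formF U -> kind3 U.
Proof.
move=> cU [x [y [P [Q [d [cP cQ] xy [xPQ yPQ] eU]]]]].
have [sp [up szp eP]] := listing P; have [sq [uq szq eQ]] := listing Q.
have u1 : uniq (sp ++ [:: x; y]).
  apply: uniq_cat_sets => //; first by rewrite /= inE xy.
  rewrite disjoint_sym (_ : [set z in [:: x; y]] = [set x; y]); last first.
    by apply/setP => z; rewrite !inE.
  by apply: disjoint_set2; rewrite -eP; [move: xPQ | move: yPQ]; rewrite inE negb_or => /andP[].
(* Labels 1 to 4 name [P], 5 and 6 name [x] and [y], and 7 and 8 name [Q]. *)
have u2 : uniq ((sp ++ [:: x; y]) ++ sq).
  apply: uniq_cat_sets => //; rewrite -eQ.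
  rewrite (_ : [set z in _] = P :|: [set x; y]); last first.
    by rewrite eP; apply/setP => z; rewrite !inE mem_cat !inE.
  rewrite -setI_eq0 setIUl (disjoint_setI0 d) set0U setI_eq0.
  by apply: disjoint_set2; [move: xPQ | move: yPQ]; rewrite inE negb_or => /andP[].
rewrite cP in szp; rewrite cQ in szq; rewrite eP eQ in eU; clear - cU eU u2 szp szq.
move: sp sq szp szq eU u2 => [|p1 [|p2 [|p3 [|p4 [|? ?]]]]] // [|q1 [|q2 [|? ?]]] // _ _ eU us.
set s := _ ++ _ in us; have fi := listing_inj (x0 := x) (erefl (size s)) us.
have eUf : U = push (fun i : 'I_8 => nth x s i)
    (sd (jbd (blk 8 [:: 5; 1; 2; 3; 4]) (blk 8 [:: 7; 8]))
        (jbd (blk 8 [:: 6; 1; 2; 3; 4]) (blk 8 [:: 7; 8]))).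
  rewrite eU push_sd // !push_jbd ?disjoint_blk // !blk_listed //=.
  by congr sd; congr jbd; apply/setP => z; rewrite !inE.
exists (fun i : 'I_8 => nth x s i); split=> //; rewrite F8_form //.
by rewrite -(vol_push fi) -eUf.
Qed.

Lemma deg_disjointU (v : V) W R : W :&: R = set0 -> deg v (W :|: R) = deg v W + deg v R.
Proof.
move=> d; rewrite /deg /vol -cardsUI.
rewrite (_ : _ :&: _ = set0) ?cards0 ?addn0; last first.
  apply/setP => B; move/setP/(_ B): d; rewrite !inE.
  by case: (B \in W) => //= ->; rewrite andbF.
by apply: eq_card => B; rewrite !inE andb_orl.
Qed.

(** Every point of [W5] has degree 5; in [R5] the points 6 and 7 have degree 5 and the others 8.
    Disjointness makes the degrees add, and 12 is not among the sums. *)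
Lemma kind1_deg U (v : V) : kind1 U -> deg v U \in [:: 0; 5; 8; 10; 13].
Proof.
move=> [W [R [_ [f [fi eW]] [g [gi eR]] d ->]]]; rewrite deg_disjointU // eW eR.
have : deg v (push f W5) \in [:: 0; 5].
  case: (deg_push_cases fi W5 v) => [->//|[i ->]].
  rewrite W5_bd -above1 card_above_bd ?subsetT //.
  by have := cardsDsub (subsetT [set i]); rewrite cards1 cardsT card_ord addn1 => -[->].
have : deg v (push g R5) \in [:: 0; 5; 8].
  case: (deg_push_cases gi R5 v) => [->//|[i ->]]; rewrite deg_coll; last by vm_compute.
  by case: i; do 7 case=> //.
rewrite /push !inE => /or3P[]/eqP-> /orP[]/eqP->.
all: by [].
Qed.

Lemma kind2_deg U : kind2 U -> exists v w : V, deg v U = 5 /\ deg w U = 12.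
Proof.
(* The ordinals 7 and 1 stand for the points 8 and 2. *)
move=> [f [fi ->]]; exists (f (inord 7)), (f (inord 1)).
by rewrite -/(push _ _) !deg_push // !deg_coll ?inordK.
Qed.

(** In the join of three boundaries on 2, 4 and 2 points, a point of the four-point part has degree
    2 * 3 * 2 = 12 and every other point of the support has degree 8. *)
Lemma kind3_deg U : kind3 U ->
  (exists v : V, deg v U = 12) /\ forall v : V, deg v U \in [:: 0; 8; 12].
Proof.
move=> [f [fi ->]]; rewrite -/(push _ _); split=> [|v].
  by exists (f (inord 0)); rewrite deg_push // deg_coll ?inordK.
case: (deg_push_cases fi F8 v) => [->//|[i ->]]; rewrite deg_coll; last by vm_compute.
by case: i; do 8 case=> //.
Qed.

End Kinds.

Theorem theorem1 (V : finType) (U : {set {set V}}) :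
  unitrade 5 U -> #|U| = 16 ->
  [\/ [/\ kind1 U, ~ kind2 U & ~ kind3 U],
      [/\ ~ kind1 U, kind2 U & ~ kind3 U]
    | [/\ ~ kind1 U, ~ kind2 U & kind3 U]].
Proof.
move=> tU cU.
have n12 : kind1 U -> ~ kind2 U.
  by move=> k1 /kind2_deg[_ [w [_ e]]]; have := kind1_deg w k1; rewrite e.
have n13 : kind1 U -> ~ kind3 U.
  by move=> k1 /kind3_deg[[w e] _]; have := kind1_deg w k1; rewrite e.
have n23 : kind2 U -> ~ kind3 U.
  by move=> /kind2_deg[v [_ [e _]]] /kind3_deg[_ /(_ v)]; rewrite e.
case: (unitrade5_16 tU cU) => [/(kind1_of_splits tU cU) k|/(kind2_of_formE cU) k|/(kind3_of_formF cU) k].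
- by constructor 1; split=> //; [apply: n12 | apply: n13].
- by constructor 2; split=> //; [move/n12 | apply: n23].
- by constructor 3; split=> //; [move/n13 | move/n23].
Qed.
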